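(* Let $f\colon\mathbb{R}^n\to\mathbb{R}\cup\{+\infty\}$ be a lower semi-continuous semi-algebraic function and let $S\subset\mathbb{R}^n$ be a closed semi-algebraic set such that $\mathrm{dom} f\cap S$ is nonempty and unbounded. Assume that the qualification condition at infinity $(\mathrm{QC})_\infty$ holds. Then the following statements are equivalent: (i) the function $f$ is coercive on $S$, i.e. for every sequence $x_k\in S$ with $\|x_k\|\to+\infty$ one has $f(x_k)\to+\infty$; (ii) $\lambda_k=+\infty$ for all $k=1,\ldots,p$.
   Context: Conventions. $\|\cdot\|$ is the Euclidean norm on $\mathbb{R}^n$; $\mathbb{B}_R$ and $\mathbb{S}_R$ are the closed ball and the sphere of radius $R>0$ centered at $0$. A subset of $\mathbb{R}^n$ is semi-algebraic if it is a finite union of sets, each defined by finitely many polynomial equalities and strict inequalities; a map is semi-algebraic if its graph is (for $f\colon\mathbb{R}^n\to\mathbb{R}\cup\{+\infty\}$ the graph is $\{(x,y)\in\mathbb{R}^n\times\mathbb{R}\mid y=f(x)\}$). $\mathrm{dom} f=\{x\mid f(x)<+\infty\}$, $\mathrm{epi} f=\{(x,\alpha)\in\mathbb{R}^n\times\mathbb{R}\mid f(x)\le\alpha\}$. Normals and subdifferentials. For $x\in S\subset\mathbb{R}^n$, the regular normal cone $\widehat N(x;S)$ is the set of $v$ with $\langle v,x'-x\rangle\le o(\|x'-x\|)$ as $x'\to x$, $x'\in S$. The limiting normal cone $N(x;S)$ is the set of $v$ for which there are $x_k\to x$, $x_k\in S$, and $v_k\to v$ with $v_k\in\widehat N(x_k;S)$.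 For $x\in\mathrm{dom} f$: $\partial f(x)=\{v\mid (v,-1)\in N((x,f(x));\mathrm{epi} f)\}$ and $\partial^\infty f(x)=\{v\mid (v,0)\in N((x,f(x));\mathrm{epi} f)\}$. $(\mathrm{QC})_\infty$: there exists $R>0$ such that $\partial^\infty f(x)\cap(-N(x;S))=\{0\}$ for all $x\in(\mathrm{dom} f\cap S)\setminus\mathbb{B}_R$. Tangency variety: $\Gamma(f,S)=\{x\in\mathrm{dom} f\cap S\mid \exists\mu\in\mathbb{R}:\ 0\in\partial f(x)+N(x;S)+\mu x\}$ (a semi-algebraic set). Decomposition at infinity. Fix a finite partition of $\Gamma(f,S)$ into semi-algebraic sets $C_1,\ldots,C_\ell$ on each of which $f$ is continuous. By Hardt's triviality theorem applied to $x\mapsto\|x\|$ on $\Gamma(f,S)$, there are $R>0$, semi-algebraic sets $F_1,\ldots,F_\ell$ and a semi-algebraic homeomorphism $h\colon(\cup_i F_i)\times(R,+\infty)\to\Gamma(f,S)\setminus\mathbb{B}_R$ with $\|h(x,t)\|=t$ and $h(F_i\times(R,+\infty))=C_i\setminus\mathbb{B}_R$ for all $i$. Let $\Gamma_1,\ldots,\Gamma_p$ be the sets $h(F'\times(R,+\infty))$, with $F'$ running over the connected components of $F_1,\ldots,F_\ell$. Thus $\Gamma(f,S)\setminus\mathbb{B}_R$ is the disjoint union of the semi-algebraic sets $\Gamma_k$; each $\Gamma_k$ is connected and unbounded, $\Gamma_k\cap\mathbb{S}_t$ is nonempty and connected for each $t>R$, and $f|_{\Gamma_k}$ is continuous. $R$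 may be increased to $R'$ by restricting $h$, i.e. replacing $\Gamma_k$ by $\Gamma_k\setminus\mathbb{B}_{R'}$. Under $(\mathrm{QC})_\infty$, for $R$ large enough $f$ is constant on each $\Gamma_k\cap\mathbb{S}_t$, $t>R$, so $f_k\colon(R,+\infty)\to\mathbb{R}$, $f_k(t):=f(x)$ for any $x\in\Gamma_k\cap\mathbb{S}_t$, is well defined; it is semi-algebraic, hence $\lambda_k:=\lim_{t\to+\infty}f_k(t)\in\mathbb{R}\cup\{\pm\infty\}$ exists. $R$ is fixed sufficiently large (the claim is for all sufficiently large $R$). *)

(* Defs.v *)
From HB Require Import structures.
From mathcomp Require Import all_boot all_order all_algebra.
From mathcomp Require Import all_classical all_reals all_analysis.
(* The notations of mpoly clash with those of the analysis library. *)
From mathcomp Require Import(canonicals) mpoly.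

Set Implicit Arguments.
Unset Strict Implicit.
Unset Printing Implicit Defensive.

Import Order.TTheory GRing.Theory Num.Theory numFieldNormedType.Exports.

Local Open Scope classical_set_scope.
Local Open Scope ring_scope.

(* The library norm of 'rV[R]_n is the sup norm; its topology is the Euclidean
   one, but the Euclidean norm itself has to be defined. *)
Definition dotv (R : realType) (n : nat) (u v : 'rV[R]_n) : R :=
  \sum_(i < n) u 0 i * v 0 i.

Definition enorm (R : realType) (n : nat) (u : 'rV[R]_n) : R :=
  Num.sqrt (dotv u u).

Definition eball (R : realType) (n : nat) (r : R) : set 'rV[R]_n :=
  [set x | enorm x <= r].

(* R^n x R is identified with R^(n + 1) = 'rV[R]_(n + 1): the pair (x, a) is
   [pairv x a], and z is the pair ([lsubmx z], [lastv z]). *)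
Definition pairv (R : realType) (n : nat) (x : 'rV[R]_n) (a : R)
  : 'rV[R]_(n + 1) := row_mx x a%:M.

Definition lastv (R : realType) (n : nat) (z : 'rV[R]_(n + 1)) : R :=
  rsubmx z 0 0.

Definition basic_semialgebraic (R : realType) (n : nat)
    (eqs ineqs : seq (mpoly.mpoly n R)) : set 'rV[R]_n :=
  [set x | (forall p, p \in eqs -> mpoly.meval (fun i => x 0 i) p = 0) /\
           (forall q, q \in ineqs -> 0 < mpoly.meval (fun i => x 0 i) q)].

Definition semialgebraic (R : realType) (n : nat) (A : set 'rV[R]_n) : Prop :=
  exists s : seq (seq (mpoly.mpoly n R) * seq (mpoly.mpoly n R)),
    A = \bigcup_(b in [set` s]) basic_semialgebraic b.1 b.2.

Definition semialgebraic_map (R : realType) (m n : nat)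
    (A : set 'rV[R]_m) (h : 'rV[R]_m -> 'rV[R]_n) : Prop :=
  semialgebraic
    [set z : 'rV[R]_(m + n) | A (lsubmx z) /\ rsubmx z = h (lsubmx z)].

Definition semialgebraic_efun (R : realType) (n : nat)
    (f : 'rV[R]_n -> \bar R) : Prop :=
  semialgebraic [set z : 'rV[R]_(n + 1) | (lastv z)%:E = f (lsubmx z)].

Definition edom (R : realType) (n : nat) (f : 'rV[R]_n -> \bar R)
  : set 'rV[R]_n := [set x | (f x < +oo)%E].

Definition epi (R : realType) (n : nat) (f : 'rV[R]_n -> \bar R)
  : set 'rV[R]_(n + 1) := [set z | (f (lsubmx z) <= (lastv z)%:E)%E].

Definition regular_normal (R : realType) (n : nat) (S : set 'rV[R]_n)
    (x : 'rV[R]_n) : set 'rV[R]_n :=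
  [set v | forall e : R, 0 < e ->
     \forall x' \near within S (nbhs x), dotv v (x' - x) <= e * enorm (x' - x)].

Definition limiting_normal (R : realType) (n : nat) (S : set 'rV[R]_n)
    (x : 'rV[R]_n) : set 'rV[R]_n :=
  [set v | exists (xs vs : nat -> 'rV[R]_n),
     [/\ forall k, S (xs k),
         xs k @[k --> \oo] --> x,
         vs k @[k --> \oo] --> v
       & forall k, regular_normal S (xs k) (vs k)]].

(* Both subdifferentials are meant at points of [edom f]. *)
Definition subdiff (R : realType) (n : nat) (f : 'rV[R]_n -> \bar R)
    (x : 'rV[R]_n) : set 'rV[R]_n :=
  [set v | limiting_normal (epi f) (pairv x (fine (f x))) (pairv v (- 1))].

Definition horizon_subdiff (R : realType) (n : nat) (f : 'rV[R]_n -> \bar R)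
    (x : 'rV[R]_n) : set 'rV[R]_n :=
  [set v | limiting_normal (epi f) (pairv x (fine (f x))) (pairv v 0)].

Definition QC_infty (R : realType) (n : nat) (f : 'rV[R]_n -> \bar R)
    (S : set 'rV[R]_n) : Prop :=
  exists2 r : R, 0 < r & forall x, ((edom f `&` S) `\` eball r) x ->
    horizon_subdiff f x `&` [set - w | w in limiting_normal S x] = [set 0].

Definition tangency_variety (R : realType) (n : nat) (f : 'rV[R]_n -> \bar R)
    (S : set 'rV[R]_n) : set 'rV[R]_n :=
  [set x | (edom f `&` S) x /\
     exists (mu : R) (v w : 'rV[R]_n),
       [/\ subdiff f x v, limiting_normal S x w & 0 = v + w + mu *: x]].

Definition coercive_on (R : realType) (n : nat) (f : 'rV[R]_n -> \bar R)
    (S : set 'rV[R]_n) : Prop :=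
  forall xs : nat -> 'rV[R]_n, (forall k, S (xs k)) ->
    enorm (xs k) @[k --> \oo] --> +oo -> f (xs k) @[k --> \oo] --> +oo%E.

Definition homeomorphism_on (T U : topologicalType) (A : set T) (B : set U)
    (h : T -> U) : Prop :=
  [/\ set_bij A B h, {within A, continuous h}
    & exists2 g : U -> T, {in A, cancel h g} & {within B, continuous g}].

(* F x (r, +oo), as a subset of R^(m + 1) *)
Definition cylinder (R : realType) (m : nat) (F : set 'rV[R]_m) (r : R)
  : set 'rV[R]_(m + 1) := [set z | F (lsubmx z) /\ r < lastv z].

Definition components (T : topologicalType) (A : set T) : set (set T) :=
  [set connected_component A x | x in A].

(* A decomposition at infinity of the tangency variety: a partition C_1, ...,
   C_l, a Hardt trivialization (F_1, ..., F_l, h) of the norm beyond radius r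
   that is compatible with it, and the resulting pieces Gam_1, ..., Gam_p, i.e.
   an enumeration without repetition of the sets h(F' x (r, +oo)), where F'
   runs over the connected components of F_1, ..., F_l. *)
Record decomposition_at_infinity (R : realType) (n : nat)
    (f : 'rV[R]_n -> \bar R) (S : set 'rV[R]_n)
    (l : nat) (C : 'I_l -> set 'rV[R]_n)
    (r : R) (m : nat) (F : 'I_l -> set 'rV[R]_m)
    (h : 'rV[R]_(m + 1) -> 'rV[R]_n)
    (p : nat) (Gam : 'I_p -> set 'rV[R]_n) : Prop := {
  dec_radius : 0 < r;
  dec_partition : partition [set: 'I_l] C (tangency_variety f S);
  dec_C_semialgebraic : forall i, semialgebraic (C i);
  dec_C_continuous : forall i, {within C i, continuous f};
  dec_F_semialgebraic : forall i, semialgebraic (F i);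
  dec_h_homeomorphism :
    homeomorphism_on (cylinder (\bigcup_i F i) r)
      (tangency_variety f S `\` eball r) h;
  dec_h_semialgebraic : semialgebraic_map (cylinder (\bigcup_i F i) r) h;
  dec_h_norm : forall z, cylinder (\bigcup_i F i) r z -> enorm (h z) = lastv z;
  dec_h_C : forall i, h @` cylinder (F i) r = C i `\` eball r;
  dec_pieces :
    set_bij [set: 'I_p]
      [set h @` cylinder F' r | F' in \bigcup_i components (F i)] Gam
}.

(* f is constant, equal to phi t, on the slice of G by the sphere of radius t,
   for every t > r.  When these slices are nonempty this determines phi on
   (r, +oo); the values of phi elsewhere are irrelevant. *)
Definition radial_value (R : realType) (n : nat) (f : 'rV[R]_n -> \bar R)
    (r : R) (G : set 'rV[R]_n) (phi : R -> R) : Prop :=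
  forall (t : R) (x : 'rV[R]_n), r < t -> G x -> enorm x = t ->
    f x = (phi t)%:E.

Definition limit_value (R : realType) (phi : R -> R) : \bar R :=
  lim ((phi t)%:E @[t --> +oo]).

(* Main.v *)
Require Import Defs.
From HB Require Import structures.
From mathcomp Require Import all_boot all_order all_algebra.
From mathcomp Require Import all_classical all_reals all_analysis.
From mathcomp Require Import ring lra.
Import Order.TTheory GRing.Theory Num.Theory numFieldNormedType.Exports.
Local Open Scope classical_set_scope.
Local Open Scope ring_scope.

(** The pieces [Gam k] cover the tangency variety beyond radius [r], and each of
    them meets every sphere of radius [t > r]. If [f] is coercive on [S], then
    following a piece along these spheres drives [f], that is [fk k], to [+oo].

    For the converse it is enough that every point [x0] of [S] far from the
    origin with [f x0] finite is accompanied by a tangency point [x] at almost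
    the same distance with [f x <= f x0] ([multipliers_near_sphere] and
    [qualification_tangency]). Indeed, [x] then lies on one of the finitely many
    pieces, where [f] is eventually above any given bound, and so is [f x0].

    Minimizing [f] on the slice of [S] by a sphere would require a qualification
    condition involving the normals of that sphere. Instead, with [q = |x0|^2],
    one minimizes [f x + K * (|x|^2 - q)^2] over the points of [S] in the shell
    [q - 1 <= |x|^2 <= q + 1]. For [K] large the minimizer is interior to the
    shell, and since the added term is smooth with gradient a multiple of [x],
    the optimality condition is exactly [0 \in df(x) + N(x; S) + mu x], provided
    that the qualification condition holds at [x] itself.

    The optimality condition is obtained by decoupling. The term
    [kappa * |x - s|^2] is added and the cost is minimized over [(x, a)] in the
    epigraph of [f] and [s] in [S] independently. Minimizers exist by compactness
    and their cluster points as [kappa] tends to infinity satisfy [x = s] and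
    solve the original problem ([penalty_limit_diagonal],
    [penalty_limit_minimizes]). Each minimizer provides opposite regular normals
    [w] to [S] and, up to the smooth gradient, [(- w, - 1)] to the epigraph. After
    division by [1 + |w|] these converge along a subsequence
    ([limit_multipliers]); the qualification condition excludes that the last
    component tends to zero. *)

(** * Euclidean norm and pairs *)

Section euclid.
Context {R : realType}.
Implicit Types (n : nat).

Lemma dotvC {n} (u v : 'rV[R]_n) : dotv u v = dotv v u.
Proof. by apply: eq_bigr => i _; rewrite mulrC. Qed.

Lemma dotvDl {n} (u v w : 'rV[R]_n) : dotv (u + v) w = dotv u w + dotv v w.
Proof. by rewrite /dotv -big_split; apply: eq_bigr => i _; rewrite mxE mulrDl. Qed.

Lemma dotvZl {n} (a : R) (u v : 'rV[R]_n) : dotv (a *: u) v = a * dotv u v.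
Proof. by rewrite /dotv mulr_sumr; apply: eq_bigr => i _; rewrite mxE mulrA. Qed.

Lemma dotvDr {n} (u v w : 'rV[R]_n) : dotv u (v + w) = dotv u v + dotv u w.
Proof. by rewrite dotvC dotvDl !(dotvC u). Qed.

Lemma dotvZr {n} (a : R) (u v : 'rV[R]_n) : dotv u (a *: v) = a * dotv u v.
Proof. by rewrite dotvC dotvZl dotvC. Qed.

Lemma dotvNl {n} (u v : 'rV[R]_n) : dotv (- u) v = - dotv u v.
Proof. by rewrite -scaleN1r dotvZl mulN1r. Qed.

Lemma dotvNr {n} (u v : 'rV[R]_n) : dotv u (- v) = - dotv u v.
Proof. by rewrite dotvC dotvNl dotvC. Qed.

Definition dotvE {n} :=
  (@dotvDl n, @dotvDr n, @dotvNl n, @dotvNr n, @dotvZl n, @dotvZr n).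

Lemma dotv0l {n} (u : 'rV[R]_n) : dotv 0 u = 0.
Proof. by rewrite -[X in dotv X _](scale0r 0) dotvZl mul0r. Qed.

Lemma dotv_sqrD {n} (u v : 'rV[R]_n) :
  dotv (u + v) (u + v) = dotv u u + 2 * dotv u v + dotv v v.
Proof. by rewrite !dotvE (dotvC v u); ring. Qed.

Lemma dotv_ge0 {n} (u : 'rV[R]_n) : 0 <= dotv u u.
Proof. by apply: sumr_ge0 => i _; rewrite -expr2 sqr_ge0. Qed.

Lemma coord_sqr_le {n} (u : 'rV[R]_n) i : u 0 i ^+ 2 <= dotv u u.
Proof.
rewrite /dotv (bigD1 i)//= -expr2 lerDl.
by apply: sumr_ge0 => j _; rewrite -expr2 sqr_ge0.
Qed.

Lemma dotv_eq0 {n} (u : 'rV[R]_n) : dotv u u = 0 -> u = 0.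
Proof.
move=> u0; apply/rowP => i; rewrite mxE; apply/eqP.
by rewrite -sqrf_eq0 eq_le sqr_ge0 andbT -u0 coord_sqr_le.
Qed.

Lemma enorm_ge0 {n} (u : 'rV[R]_n) : 0 <= enorm u.
Proof. exact: sqrtr_ge0. Qed.

Lemma sqr_enorm {n} (u : 'rV[R]_n) : enorm u ^+ 2 = dotv u u.
Proof. by rewrite sqr_sqrtr// dotv_ge0. Qed.

Lemma enormZ {n} (a : R) (u : 'rV[R]_n) : 0 <= a -> enorm (a *: u) = a * enorm u.
Proof.
by move=> a0; rewrite /enorm !dotvE mulrA -expr2 sqrtrM ?sqr_ge0// sqrtr_sqr ger0_norm.
Qed.

Lemma enorm0 n : enorm (0 : 'rV[R]_n) = 0.
Proof. by rewrite -(scale0r 0) enormZ// mul0r. Qed.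

Lemma cauchy_schwarz {n} (u v : 'rV[R]_n) : dotv u v ^+ 2 <= dotv u u * dotv v v.
Proof.
have [v0|v0] := eqVneq (dotv v v) 0.
  by rewrite (dotv_eq0 _ v0) -(scale0r 0) !dotvE !mul0r expr0n mulr0.
have vpos : 0 < dotv v v by rewrite lt_neqAle eq_sym v0 dotv_ge0.
have := dotv_ge0 (dotv v v *: u - dotv u v *: v).
rewrite !dotvE (dotvC v u) => h.
rewrite -subr_ge0 -(pmulr_rge0 _ vpos); apply: le_trans h _.
by rewrite le_eqVlt; apply/orP; left; apply/eqP; ring.
Qed.

Lemma lsubmx_pairv {n} (x : 'rV[R]_n) a : lsubmx (pairv x a) = x.
Proof. exact: row_mxKl. Qed.

Lemma lastv_pairv {n} (x : 'rV[R]_n) a : lastv (pairv x a) = a.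
Proof. by rewrite /lastv /pairv row_mxKr mxE eqxx mulr1n. Qed.

Lemma pairv_eta {n} (z : 'rV[R]_(n + 1)) : z = pairv (lsubmx z) (lastv z).
Proof.
rewrite /pairv /lastv -[LHS]hsubmxK; congr row_mx.
by apply/rowP => i; rewrite !ord1 [in RHS]mxE eqxx mulr1n.
Qed.

Lemma lastvB {n} (y z : 'rV[R]_(n + 1)) : lastv (y - z) = lastv y - lastv z.
Proof. by rewrite /lastv !mxE. Qed.

Lemma lsubmxB {n} (y z : 'rV[R]_(n + 1)) : lsubmx (y - z) = lsubmx y - lsubmx z.
Proof. by rewrite linearB. Qed.

Lemma scale_pairv {n} (c : R) (x : 'rV[R]_n) a :
  c *: pairv x a = pairv (c *: x) (c * a).
Proof. by rewrite /pairv scale_row_mx scale_scalar_mx. Qed.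

Lemma opp_pairv {n} (x : 'rV[R]_n) a : - pairv x a = pairv (- x) (- a).
Proof. by rewrite -scaleN1r scale_pairv scaleN1r mulN1r. Qed.

Lemma dotv_split {n} (y z : 'rV[R]_(n + 1)) :
  dotv y z = dotv (lsubmx y) (lsubmx z) + lastv y * lastv z.
Proof.
rewrite /dotv big_split_ord /= big_ord1 /lastv !mxE; congr (_ + _).
by apply: eq_bigr => i _; rewrite !mxE.
Qed.

Lemma dotv_lsubmx_le {n} (z : 'rV[R]_(n + 1)) :
  dotv (lsubmx z) (lsubmx z) <= dotv z z.
Proof. by rewrite dotv_split lerDl -expr2 sqr_ge0. Qed.

Lemma cvg_row {T : Type} {F : set_system T} {FF : Filter F} {n}
    {u : T -> 'rV[R]_n} {x : 'rV[R]_n} :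
  (forall i, u t 0 i @[t --> F] --> x 0 i) -> u t @[t --> F] --> x.
Proof.
move=> ux; apply/cvg_ballP => e e0.
have : \forall t \near F, forall i, ball (x 0 i) e (u t 0 i).
  by apply: filter_forall => i; move/cvg_ballP: (ux i); apply.
by apply: filterS => t ut; split=> // i j; rewrite !ord1.
Qed.

Lemma cvg_coord {T : Type} {F : set_system T} {FF : Filter F} {n}
    {u : T -> 'rV[R]_n} {x : 'rV[R]_n} i :
  u t @[t --> F] --> x -> u t 0 i @[t --> F] --> x 0 i.
Proof. by move=> ux; apply: (cvg_comp _ (fun M : 'rV[R]_n => M 0 i) ux);
  exact: coord_continuous. Qed.

Lemma cvg_dotv {T : Type} {F : set_system T} {FF : Filter F} {n}
    {u v : T -> 'rV[R]_n} {x y : 'rV[R]_n} :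
  u t @[t --> F] --> x -> v t @[t --> F] --> y ->
  dotv (u t) (v t) @[t --> F] --> dotv x y.
Proof.
move=> ux vy; rewrite /dotv; apply: cvg_big => [|i _]; first exact: add_continuous.
by apply: cvgM; exact: cvg_coord.
Qed.

Lemma cvg_enorm {T : Type} {F : set_system T} {FF : Filter F} {n}
    {u : T -> 'rV[R]_n} {x : 'rV[R]_n} :
  u t @[t --> F] --> x -> enorm (u t) @[t --> F] --> enorm x.
Proof.
move=> ux; rewrite /enorm.
by apply: (cvg_comp _ Num.sqrt (cvg_dotv ux ux)); exact: sqrt_continuous.
Qed.

Lemma cvg_lsubmx {T : Type} {F : set_system T} {FF : Filter F} {n}
    {u : T -> 'rV[R]_(n + 1)} {x : 'rV[R]_(n + 1)} :
  u t @[t --> F] --> x -> lsubmx (u t) @[t --> F] --> lsubmx x.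
Proof.
move=> ux; apply: cvg_row => i; rewrite mxE.
by under eq_cvg do rewrite mxE; exact: cvg_coord.
Qed.

Lemma cvg_lastv {T : Type} {F : set_system T} {FF : Filter F} {n}
    {u : T -> 'rV[R]_(n + 1)} {x : 'rV[R]_(n + 1)} :
  u t @[t --> F] --> x -> lastv (u t) @[t --> F] --> lastv x.
Proof.
move=> ux; rewrite /lastv mxE.
by under eq_cvg do rewrite mxE; exact: cvg_coord.
Qed.

Lemma cvg_pairv {T : Type} {F : set_system T} {FF : Filter F} {n}
    {u : T -> 'rV[R]_n} {a : T -> R} {x : 'rV[R]_n} {b : R} :
  u t @[t --> F] --> x -> a t @[t --> F] --> b ->
  pairv (u t) (a t) @[t --> F] --> pairv x b.
Proof.
move=> ux ab; apply: cvg_row => i; rewrite /pairv.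
case: (split_ordP i) => j ->.
  by rewrite row_mxEl; under eq_cvg do rewrite row_mxEl; exact: cvg_coord.
rewrite row_mxEr ord1 mxE eqxx mulr1n.
by under eq_cvg do rewrite row_mxEr mxE eqxx mulr1n.
Qed.

Lemma near_enorm_lt {n} (x : 'rV[R]_n) (e : R) : 0 < e ->
  \forall y \near x, enorm (y - x) < e.
Proof.
move=> e0.
have sub : y - x @[y --> x] --> x - x.
  by apply: (@cvgB R 'rV[R]_n 'rV[R]_n (nbhs x) _ id (cst x)) => //; exact: cvg_cst.
have : enorm (y - x) @[y --> x] --> enorm (x - x).
  exact: (@cvg_enorm _ (nbhs x) _ _ _ _ sub).
by rewrite subrr enorm0 => h; exact: (cvgr_lt _ h _ e0).
Qed.

Lemma dotv_bounded_compact {n} (A : set 'rV[R]_n) (r : R) :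
  closed A -> (forall x, A x -> dotv x x <= r) -> compact A.
Proof.
move=> Acl Ar.
have box : compact [set x : 'rV[R]_n | forall i, `[- (1 + r), 1 + r]%classic (x 0 i)].
  by apply: (@rV_compact R n (fun=> `[- (1 + r), 1 + r]%classic)) => _;
    exact: segment_compact.
apply: subclosed_compact Acl box _ => x Ax i.
have := le_trans (coord_sqr_le x i) (Ar _ Ax) => xi.
by rewrite /= in_itv/=; apply/andP; split; nra.
Qed.

Lemma continuous_dotv_self n : continuous (fun x : 'rV[R]_n => dotv x x).
Proof. by move=> x; exact: (@cvg_dotv _ (nbhs x)). Qed.

Lemma continuous_lsubmx n : continuous (@lsubmx R 1 n 1).
Proof. by move=> z; exact: (@cvg_lsubmx _ (nbhs z)). Qed.

Lemma continuous_lastv n : continuous (@lastv R n).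
Proof. by move=> z; exact: (@cvg_lastv _ (nbhs z)). Qed.

Lemma continuous_dotv_lsubmx n :
  continuous (fun z : 'rV[R]_(n + 1) => dotv (lsubmx z) (lsubmx z)).
Proof.
by move=> z; apply: (@cvg_dotv _ (nbhs z)); exact: (@cvg_lsubmx _ (nbhs z)).
Qed.

Lemma sublevel_dotv_compact n (r : R) : compact [set x : 'rV[R]_n | dotv x x <= r].
Proof.
apply: (@dotv_bounded_compact _ _ r) => [|//].
rewrite (_ : mkset _ = (fun x => dotv x x) @^-1` `]-oo, r]%classic).
  apply: closed_comp => [x _|]; last exact: interval_closed.
  exact: continuous_dotv_self.
by apply/seteqP; split=> s; rewrite /= in_itv.
Qed.

End euclid.

Lemma cvg_pair_fst {T : Type} {F : set_system T} {U V : topologicalType}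
    {u : T -> U * V} {a : U} {b : V} :
  u t @[t --> F] --> (a, b) -> (u t).1 @[t --> F] --> a.
Proof. by move=> uab; apply: (cvg_comp u fst uab); exact: cvg_fst. Qed.

Lemma cvg_pair_snd {T : Type} {F : set_system T} {U V : topologicalType}
    {u : T -> U * V} {a : U} {b : V} :
  u t @[t --> F] --> (a, b) -> (u t).2 @[t --> F] --> b.
Proof. by move=> uab; apply: (cvg_comp u snd uab); exact: cvg_snd. Qed.

Lemma compact_subsequence {R : realType} {T : pseudoMetricType R} {A : set T}
    {u : nat -> T} : compact A -> (forall k, A (u k)) ->
  exists2 a, A a & exists2 phi : nat -> nat,
    (forall k, (k <= phi k)%N) & u (phi k) @[k --> \oo] --> a.
Proof.
move=> cA Au; have [|a [Aa ua]] := cA (u @ \oo) _.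
  by exists 0%N => // k _; exact: Au.
exists a => //.
have /choice[phi phiP] : forall k, exists j, (k <= j)%N /\ ball a k.+1%:R^-1 (u j).
  move=> k.
  have tail : (u @ \oo) [set u j | j in [set j | (k <= j)%N]].
    by exists k => // j kj; exists j.
  have close : nbhs a (ball a k.+1%:R^-1) by exact: nbhsx_ballx.
  by have [_ [[j kj <-] aj]] := ua _ _ tail close; exists j.
exists phi => [k|]; first by have [] := phiP k.
apply/cvg_ballP => e e0; near=> k; have [_ ] := phiP k; apply: le_ball.
by apply: ltW; near: k; exact: (near_infty_natSinv_lt (PosNum e0)).
Unshelve. all: end_near. Qed.

(** * Normal cones and epigraphs *)

Section normals.
Context {R : realType}.

(** A quadratic upper model of [phi] is all that is needed: minimality bounds
    [- dotv g (y - z)] by the quadratic remainder, which is [o(|y - z|)]. *)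
Lemma regular_normal_local_min {n} {A : set 'rV[R]_n} {z g : 'rV[R]_n}
    {phi : 'rV[R]_n -> R} {L : R} : 0 <= L ->
  (\forall y \near within A (nbhs z), phi z <= phi y) ->
  (\forall y \near z, phi y <=
     phi z + dotv g (y - z) + L * dotv (y - z) (y - z)) ->
  regular_normal A z (- g).
Proof.
move=> L0 zmin taylor e e0.
have eL : 0 < e / (L + 1) by rewrite divr_gt0// ltr_wpDl.
have zmin' : \forall y \near z, A y -> phi z <= phi y by exact: zmin.
have H : \forall y \near z, A y -> dotv (- g) (y - z) <= e * enorm (y - z).
  near=> y => Ay.
  have py : phi z <= phi y by apply: (near zmin' y).
  have ty : phi y <= phi z + dotv g (y - z) + L * dotv (y - z) (y - z).
    by near: y.
  have : enorm (y - z) < e / (L + 1) by near: y; exact: near_enorm_lt.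
  rewrite ltr_pdivlMr ?ltr_wpDl// => dy.
  have d0 := enorm_ge0 (y - z).
  by move: ty; rewrite -sqr_enorm dotvNl => ty; nra.
exact: H.
Unshelve. all: end_near. Qed.

Lemma regular_normalZ {n} {A : set 'rV[R]_n} {x v : 'rV[R]_n} {c : R} :
  0 < c -> regular_normal A x v -> regular_normal A x (c *: v).
Proof.
move=> c0 xv e e0.
have H : \forall y \near within A (nbhs x),
    dotv v (y - x) <= (e / c) * enorm (y - x) by apply: xv; rewrite divr_gt0.
apply: filterS H => y; rewrite dotvZl.
by rewrite mulrAC ler_pdivlMr// mulrC.
Qed.

Lemma limiting_normal_near {n} {A : set 'rV[R]_n} {x v : 'rV[R]_n}
    {xs vs : nat -> 'rV[R]_n} :
  (forall k, A (xs k)) -> xs k @[k --> \oo] --> x -> vs k @[k --> \oo] --> v ->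
  (\forall k \near \oo, regular_normal A (xs k) (vs k)) ->
  limiting_normal A x v.
Proof.
move=> Axs xsx vsv [N _ NN].
exists (fun k => xs (k + N)%N), (fun k => vs (k + N)%N); split => //.
- by rewrite (cvg_shiftn N xs).
- by rewrite (cvg_shiftn N vs).
- by move=> k; apply: NN; rewrite /= leq_addl.
Qed.

Lemma limiting_normalZ {n} {A : set 'rV[R]_n} {x v : 'rV[R]_n} {c : R} :
  0 < c -> limiting_normal A x v -> limiting_normal A x (c *: v).
Proof.
move=> c0 [xs [vs [Axs xsx vsv reg]]].
exists xs, (fun k => c *: vs k); split => //; first exact: cvgZr.
by move=> k; exact: regular_normalZ.
Qed.

End normals.

Section epigraph.
Context {R : realType} {n : nat} {f : 'rV[R]_n -> \bar R}.
Hypothesis f_proper : forall x, f x != -oo%E.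
Hypothesis f_lsc : lower_semicontinuous f.

Lemma epi_closed : closed (epi f).
Proof.
rewrite -openC openE => z /= /negP; rewrite -ltNge => fz.
have [b zb bf] : exists2 b, lastv z < b & (b%:E < f (lsubmx z))%E.
  move: fz; case: (f (lsubmx z)) => [a| |//].
  - rewrite lte_fin => za; exists ((lastv z + a) / 2); first lra.
    by rewrite lte_fin; lra.
  - by move=> _; exists (lastv z + 1); [lra | rewrite ltry].
have [V Vz Vf] := f_lsc _ _ bf.
have lsub : lsubmx y @[y --> z] --> lsubmx z by exact: (@cvg_lsubmx _ _ (nbhs z)).
have last : lastv y @[y --> z] --> lastv z by exact: (@cvg_lastv _ _ (nbhs z)).
have V1 : \forall y \near z, V (lsubmx y) by exact: lsub.
have V2 : \forall y \near z, lastv y < b by exact: (cvgr_lt _ last _ zb).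
near=> y => /=; apply/negP; rewrite -ltNge.
rewrite (lt_trans _ (Vf (lsubmx y) _)) ?lte_fin//; first by near: y.
by near: y.
Unshelve. all: end_near. Qed.

(** Lower semicontinuity gives a lower bound on a neighborhood of each point,
    since [f] avoids [-oo]; compactness makes it uniform. *)
Lemma lsc_bounded_below {K : set 'rV[R]_n} :
  compact K -> exists b : R, forall x, K x -> ((- b)%:E < f x)%E.
Proof.
move=> /compact_near_coveringP cK.
have [|M [_ MP]] := cK R +oo (fun b x => ((- b)%:E < f x)%E) _.
  move=> x Kx.
  have [b bf] : exists b : R, ((- b)%:E < f x)%E.
    move: (f_proper x); case: (f x) => [a| |//] _.
    - by exists (1 - a); rewrite lte_fin; lra.
    - by exists 0; rewrite ltry.
  have [V Vx Vf] := f_lsc _ _ bf.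
  exists (V, [set a | b < a]).
    by split => //; exists b; split => //; exact: num_real.
  move=> [y a] [/= Vy ba]; apply: lt_trans (Vf y Vy).
  by rewrite lte_fin ltrN2.
by exists (M + 1); apply: MP; rewrite ltrDl.
Qed.


End epigraph.

(** * The penalized problem *)

Section penalization.
Context {R : realType} {n : nat}.
Implicit Types (z : 'rV[R]_(n + 1)) (s x y : 'rV[R]_n).
Variables K q : R.
Hypothesis K0 : 0 <= K.

Definition shell_cost z : R :=
  lastv z + K * (dotv (lsubmx z) (lsubmx z) - q) ^+ 2.

(** A pair in the epigraph and a point [s] of the constraint set are optimized
    independently; the weight [kappa] forces them together in the limit, and it
    is this decoupling that separates the normals of the two sets. *)
Definition penalized (kappa : R) z s : R :=
  shell_cost z + kappa * dotv (lsubmx z - s) (lsubmx z - s).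

(** The gradient of [K * (|x|^2 - q)^2] is [multiplier x *: x]. That it is a
    multiple of [x] is why minimizers are tangency points. *)
Definition multiplier x : R := K * (4 * (dotv x x - q)).

(** The constant bounds the second order terms: with [N] for [|y - x|^2 <= 1],
    the square of [2 * dotv x (y - x) + N] is at most [8 * |x|^2 * N + 2 * N] by
    the Cauchy-Schwarz inequality. *)
Lemma shell_taylor x y : enorm (y - x) < 1 ->
  (dotv y y - q) ^+ 2 <=
  (dotv x x - q) ^+ 2 + 4 * (dotv x x - q) * dotv x (y - x) +
  (2 * `|dotv x x - q| + 8 * dotv x x + 2) * dotv (y - x) (y - x).
Proof.
move=> d1; have N1 : dotv (y - x) (y - x) <= 1.
  by rewrite -sqr_enorm exprn_ile1// ?enorm_ge0// ltW.
have := cauchy_schwarz x (y - x).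
have -> : dotv y y = dotv x x + 2 * dotv x (y - x) + dotv (y - x) (y - x).
  by rewrite -dotv_sqrD addrC subrK.
move: N1 (dotv_ge0 x) (dotv_ge0 (y - x)).
move: (dotv x x) (dotv x (y - x)) (dotv (y - x) (y - x)) => X p N N1 X0 N0 pXN.
have aN : (X - q) * N <= `|X - q| * N by rewrite ler_wpM2r// ler_norm.
have sq := sqr_ge0 (2 * p - N).
have NN : N ^+ 2 <= N by rewrite expr2 ler_piMl.
nra.
Qed.

Lemma regular_normal_penalized_fst {E : set 'rV[R]_(n + 1)} {kappa : R} {z s} :
  0 <= kappa ->
  (\forall y \near within E (nbhs z), penalized kappa z s <= penalized kappa y s) ->
  regular_normal E z
    (pairv (- (multiplier (lsubmx z) *: lsubmx z + (2 * kappa) *: (lsubmx z - s)))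
       (- 1)).
Proof.
move=> kappa0 zmin; set x := lsubmx z; rewrite -opp_pairv.
pose L := K * (2 * `|dotv x x - q| + 8 * dotv x x + 2) + kappa.
have L0 : 0 <= 2 * `|dotv x x - q| + 8 * dotv x x + 2.
  by have := normr_ge0 (dotv x x - q); have := dotv_ge0 x; lra.
apply: (regular_normal_local_min (phi := penalized kappa ^~ s) (L := L)) zmin _.
  by rewrite addr_ge0// mulr_ge0.
near=> y.
have dxy : enorm (lsubmx y - x) < 1.
  rewrite -lsubmxB; apply: (@le_lt_trans _ _ (enorm (y - z))).
    by rewrite ler_wsqrtr// dotv_lsubmx_le.
  by near: y; exact: near_enorm_lt.
have := ler_wpM2l K0 (shell_taylor x _ dxy).
rewrite /penalized /shell_cost (dotv_split (pairv _ _)) lsubmx_pairv lastv_pairv.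
rewrite lastvB lsubmxB -/x.
have -> : lsubmx y - s = (x - s) + (lsubmx y - x) by rewrite [RHS]addrC subrKA.
have := dotv_lsubmx_le (y - z); rewrite lsubmxB -/x.
move: dxy; set d := lsubmx y - x => dxy dN.
rewrite (dotv_sqrD (x - s) d) (dotvDl (_ *: x)) !dotvZl /multiplier.
have /(ler_wpM2l) -/(_ L) := dN.
rewrite addr_ge0 ?mulr_ge0// => /(_ isT).
rewrite /L; move: (dotv (y - z) _) (dotv d d) (dotv x d) (dotv (x - s) d).
move=> N Nd p r; nra.
Unshelve. all: end_near. Qed.

Lemma regular_normal_penalized_snd {S : set 'rV[R]_n} {kappa : R} {z s} :
  0 <= kappa ->
  (\forall t \near within S (nbhs s), penalized kappa z s <= penalized kappa z t) ->
  regular_normal S s ((2 * kappa) *: (lsubmx z - s)).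
Proof.
move=> kappa0 smin; rewrite -[X in regular_normal _ _ X]opprK.
apply: (regular_normal_local_min (phi := penalized kappa z) (L := kappa)) smin _ => //.
near=> t; rewrite /penalized le_eqVlt; apply/orP; left; apply/eqP.
have -> : lsubmx z - t = (lsubmx z - s) - (t - s) by rewrite opprB addrA subrK.
move: (lsubmx z - s) (t - s) => v d.
rewrite dotv_sqrD !(dotvNl, dotvNr, dotvZl); ring.
Unshelve. all: end_near. Qed.

Lemma cvg_shell_cost {T : Type} {F : set_system T} {FF : Filter F}
    {u : T -> 'rV[R]_(n + 1)} {z} :
  u t @[t --> F] --> z -> shell_cost (u t) @[t --> F] --> shell_cost z.
Proof.
move=> uz.
have ux : lsubmx (u t) @[t --> F] --> lsubmx z by exact: cvg_lsubmx.
have shell : (dotv (lsubmx (u t)) (lsubmx (u t)) - q) ^+ 2 @[t --> F] -->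
    (dotv (lsubmx z) (lsubmx z) - q) ^+ 2.
  under eq_cvg do rewrite expr2.
  by rewrite expr2; apply: cvgM; apply: cvgB; by [exact: cvg_dotv | exact: cvg_cst].
by apply: cvgD; [exact: cvg_lastv | exact: cvgMr].
Qed.

Lemma cvg_penalized {T : Type} {F : set_system T} {FF : Filter F} {kappa : R}
    {u : T -> 'rV[R]_(n + 1)} {v : T -> 'rV[R]_n} {z s} :
  u t @[t --> F] --> z -> v t @[t --> F] --> s ->
  penalized kappa (u t) (v t) @[t --> F] --> penalized kappa z s.
Proof.
move=> uz vs.
have ux : lsubmx (u t) @[t --> F] --> lsubmx z by exact: cvg_lsubmx.
have uv : lsubmx (u t) - v t @[t --> F] --> lsubmx z - s.
  exact: (@cvgB R 'rV[R]_n T F FF _ _ _ _ ux vs).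
by apply: cvgD; [exact: cvg_shell_cost | apply: cvgMr; exact: cvg_dotv].
Qed.

Lemma penalized_minimum (kappa : R) {A : set 'rV[R]_(n + 1)} {B : set 'rV[R]_n} :
  compact A -> compact B -> A `*` B !=set0 ->
  exists p, (A `*` B) p /\ forall p', (A `*` B) p' ->
    penalized kappa p.1 p.2 <= penalized kappa p'.1 p'.2.
Proof.
move=> cA cB AB0.
have cont : {within A `*` B, continuous
    (fun p : 'rV[R]_(n + 1) * 'rV[R]_n => penalized kappa p.1 p.2)}.
  apply: continuous_subspaceT => p.
  by apply: (@cvg_penalized _ (nbhs p)); [exact: cvg_fst | exact: cvg_snd].
have [p pAB pmin] := compact_EVT_min AB0 (compact_setX cA cB) cont.
exists p; split; first by rewrite inE in pAB.
by move=> p' p'AB; apply: pmin; rewrite inE.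
Qed.

Section penalty_limit.
Context {A : set 'rV[R]_(n + 1)} {B : set 'rV[R]_n} {b : R}.
Context {p : nat -> 'rV[R]_(n + 1) * 'rV[R]_n} {phi : nat -> nat}.
Context {z : 'rV[R]_(n + 1)} {s : 'rV[R]_n}.
Hypothesis A_bounded : forall z0, A z0 -> - b <= lastv z0.
Hypothesis p_min : forall k, (A `*` B) (p k) /\ forall p', (A `*` B) p' ->
  penalized k.+1%:R (p k).1 (p k).2 <= penalized k.+1%:R p'.1 p'.2.
Hypothesis phi_ge : forall k, (k <= phi k)%N.
Hypothesis cvg_p : p (phi k) @[k --> \oo] --> (z, s).

(** A pair whose two components agree pays no penalty, so its cost is an upper
    bound for the minimum at every weight. *)
Let p_le {z0} k : A z0 -> B (lsubmx z0) ->
  penalized k.+1%:R (p k).1 (p k).2 <= shell_cost z0.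
Proof.
move=> Az0 Bz0; have [_ /(_ (z0, lsubmx z0) (conj Az0 Bz0))] := p_min k.
by rewrite /penalized /= subrr dotv0l mulr0 addr0.
Qed.

(** The penalty stays bounded because the minima are bounded above by the cost of
    [z0], while the weights tend to infinity. *)
Lemma penalty_limit_diagonal {z0} : A z0 -> B (lsubmx z0) -> lsubmx z = s.
Proof.
move=> Az0 Bz0; pose gap k := lsubmx (p (phi k)).1 - (p (phi k)).2.
pose N := shell_cost z0 + b.
(* The weight of the [phi k]-th problem is at least [k.+1]. *)
have gap_le k : dotv (gap k) (gap k) <= N * harmonic k.
  rewrite /= ler_pdivlMr//.
  have := p_le (phi k) Az0 Bz0; rewrite /penalized /shell_cost -/(gap k).
  have [[Ap _] _] := p_min (phi k); have := A_bounded _ Ap.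
  have k_phi : k.+1%:R <= (phi k).+1%:R :> R by rewrite ler_nat ltnS.
  have := ler_wpM2l (dotv_ge0 (gap k)) k_phi.
  have := mulr_ge0 K0 (sqr_ge0
    (dotv (lsubmx (p (phi k)).1) (lsubmx (p (phi k)).1) - q)).
  by rewrite /N /shell_cost; lra.
have cvg_gap : gap k @[k --> \oo] --> lsubmx z - s.
  apply: (@cvgB R 'rV[R]_n nat \oo).
    by apply: cvg_lsubmx; exact: cvg_pair_fst cvg_p.
  exact: cvg_pair_snd cvg_p.
have lim0 : N * harmonic k @[k --> \oo] --> N * 0.
  by apply: cvgMr; exact: cvg_harmonic.
apply/subr0_eq/dotv_eq0/eqP; rewrite eq_le dotv_ge0 andbT -[leRHS](mulr0 N).
apply: (ler_cvg_to (cvg_dotv cvg_gap cvg_gap) lim0).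
by apply: nearW => k; exact: gap_le.
Qed.

Lemma penalty_limit_minimizes {z0} :
  A z0 -> B (lsubmx z0) -> shell_cost z <= shell_cost z0.
Proof.
move=> Az0 Bz0.
have cvg_cost : shell_cost (p (phi k)).1 @[k --> \oo] --> shell_cost z.
  by apply: cvg_shell_cost; exact: cvg_pair_fst cvg_p.
apply: (ler_cvg_to cvg_cost (cvg_cst (shell_cost z0))).
apply: nearW => k; apply: le_trans (p_le (phi k) Az0 Bz0).
by rewrite /penalized lerDl mulr_ge0// dotv_ge0.
Qed.

End penalty_limit.

(** The normals [2 * kappa k *: (x_k - s_k)] produced by the penalty may be
    unbounded. Dividing by [1 + |.|] makes them subconverge together with the
    scaling factor, whose limit [c] becomes the multiplier of the objective:
    [c = 0] is exactly the unbounded case, a multiplier rule of Fritz John type. *)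
Lemma limit_multipliers {E : set 'rV[R]_(n + 1)} {S : set 'rV[R]_n}
    {zs : nat -> 'rV[R]_(n + 1)} {ss : nat -> 'rV[R]_n} {kappa : nat -> R} {z} :
  (forall k, E (zs k)) -> (forall k, S (ss k)) -> (forall k, 0 <= kappa k) ->
  zs k @[k --> \oo] --> z -> ss k @[k --> \oo] --> lsubmx z ->
  (\forall k \near \oo, \forall y \near within E (nbhs (zs k)),
     penalized (kappa k) (zs k) (ss k) <= penalized (kappa k) y (ss k)) ->
  (\forall k \near \oo, \forall t \near within S (nbhs (ss k)),
     penalized (kappa k) (zs k) (ss k) <= penalized (kappa k) (zs k) t) ->
  exists (w : 'rV[R]_n) (c : R),
  [/\ 0 <= c, c + enorm w = 1, limiting_normal S (lsubmx z) w &
      limiting_normal E z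
        (pairv (- (c *: (multiplier (lsubmx z) *: lsubmx z) + w)) (- c))].
Proof.
move=> Ezs Sss kappa0 cvg_z cvg_s min_z min_s.
pose w k := (2 * kappa k) *: (lsubmx (zs k) - ss k).
pose c k := (1 + enorm (w k))^-1.
have c_gt0 k : 0 < c k by rewrite invr_gt0 ltr_pwDl// enorm_ge0.
have cw k : c k + enorm (c k *: w k) = 1.
  rewrite enormZ ?ltW// -{1}(mulr1 (c k)) -mulrDr mulVf//.
  by rewrite gt_eqF// ltr_pwDl// enorm_ge0.
pose box : set 'rV[R]_(n + 1) := [set v | dotv v v <= 2].
have box_cw k : box (pairv (c k *: w k) (c k)).
  rewrite /box/= dotv_split lsubmx_pairv lastv_pairv -sqr_enorm.
  have := cw k; have := c_gt0 k; have := enorm_ge0 (c k *: w k).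
  by move: (c k) (enorm _) => a e; nra.
have [v _ [psi psi_ge cvg_cw]] :=
  compact_subsequence (sublevel_dotv_compact (n + 1) 2) box_cw.
have psi_oo : psi k @[k --> \oo] --> \oo.
  by move=> U [N _ NU]; exists N => // k /= Nk; apply: NU; exact: leq_trans (psi_ge k).
have cvg_zpsi : zs (psi k) @[k --> \oo] --> z := cvg_comp _ _ psi_oo cvg_z.
have cvg_spsi : ss (psi k) @[k --> \oo] --> lsubmx z := cvg_comp _ _ psi_oo cvg_s.
have cvg_xpsi : lsubmx (zs (psi k)) @[k --> \oo] --> lsubmx z by exact: cvg_lsubmx.
have cvg_w : c (psi k) *: w (psi k) @[k --> \oo] --> lsubmx v.
  by have := cvg_lsubmx cvg_cw; under eq_cvg do rewrite lsubmx_pairv; exact.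
have cvg_c : c (psi k) @[k --> \oo] --> lastv v.
  by have := cvg_lastv cvg_cw; under eq_cvg do rewrite lastv_pairv; exact.
exists (lsubmx v), (lastv v); split.
- apply: (ler_cvg_to (cvg_cst 0) cvg_c).
  by apply: nearW => k; exact: ltW.
- have lim_sum : c (psi k) + enorm (c (psi k) *: w (psi k)) @[k --> \oo] -->
      lastv v + enorm (lsubmx v) by apply: cvgD => //; exact: cvg_enorm.
  have lim_one : c (psi k) + enorm (c (psi k) *: w (psi k)) @[k --> \oo] --> (1 : R).
    by under eq_cvg do rewrite cw; exact: cvg_cst.
  exact: (cvg_unique _ lim_sum lim_one).
- apply: (limiting_normal_near (xs := fun k => ss (psi k))) cvg_w _ => //.
  apply: (@filterS _ \oo _ _ _ _ (psi_oo _ min_s)) => k min_k.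
  by apply: regular_normalZ => //; exact: regular_normal_penalized_snd.
have cvg_theta : multiplier (lsubmx (zs (psi k))) @[k --> \oo] -->
    multiplier (lsubmx z).
  apply: cvgMr; apply: cvgMr; apply: cvgB; last exact: cvg_cst.
  exact: cvg_dotv.
pose g k := multiplier (lsubmx (zs k)) *: lsubmx (zs k).
apply: (limiting_normal_near (xs := fun k => zs (psi k))
  (vs := fun k => pairv (- (c (psi k) *: g (psi k) + c (psi k) *: w (psi k)))
                    (- c (psi k)))) => //.
  apply: cvg_pairv; last exact: cvgN.
  apply: (@cvgN R 'rV[R]_n); apply: (@cvgD R 'rV[R]_n) => //.
  by apply: cvgZ => //; apply: cvgZ.
apply: (@filterS _ \oo _ _ _ _ (psi_oo _ min_z)) => k min_k.
have -> : pairv (- (c (psi k) *: g (psi k) + c (psi k) *: w (psi k))) (- c (psi k)) =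
    c (psi k) *: pairv (- (g (psi k) + w (psi k))) (- 1).
  by rewrite scale_pairv mulrN1 scalerN scalerDr.
by apply: regular_normalZ => //; exact: regular_normal_penalized_fst.
Qed.

End penalization.

(** * From far points to tangency points *)

Section tangency.
Context {R : realType} {n : nat} {f : 'rV[R]_n -> \bar R} {S : set 'rV[R]_n}.
Hypothesis f_proper : forall x, f x != -oo%E.
Hypothesis f_lsc : lower_semicontinuous f.
Hypothesis S_closed : closed S.

Definition shell (q : R) : set 'rV[R]_n := [set x | q - 1 <= dotv x x <= q + 1].

Lemma shell_compact q : compact (shell q).
Proof.
apply: (@dotv_bounded_compact _ _ _ (q + 1)) => [|x /andP[]//].
have -> : shell q = (fun x => dotv x x) @^-1` `[q - 1, q + 1]%classic.
  by apply/seteqP; split=> x; rewrite /shell /= in_itv.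
by apply: closed_comp => [x _|]; [exact: continuous_dotv_self | exact: interval_closed].
Qed.

Lemma epi_shell_compact (q M b : R) :
  (forall x, shell q x -> ((- b)%:E < f x)%E) ->
  compact [set z | [/\ epi f z, shell q (lsubmx z) & lastv z <= M]].
Proof.
move=> fb.
apply: (@dotv_bounded_compact _ _ _ (q + 1 + M ^+ 2 + b ^+ 2)) => [|z [zf zq zM]].
  rewrite (_ : mkset _ = epi f `&` ((@lsubmx R 1 n 1) @^-1` shell q `&`
      (@lastv R n) @^-1` `]-oo, M]%classic)); last first.
    apply/seteqP; split=> z; rewrite /= in_itv/=; first by case.
    by case=> ? [].
  apply: closedI; first exact: epi_closed.
  apply: closedI; apply: closed_comp.
  - by move=> z _; exact: continuous_lsubmx.
  - exact: compact_closed (shell_compact q).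
  - by move=> z _; exact: continuous_lastv.
  - exact: interval_closed.
rewrite dotv_split.
have zb : - b < lastv z by rewrite -lte_fin (lt_le_trans (fb _ zq)).
by move: zq => /andP[_ zq]; have [z0|z0] := leP 0 (lastv z); nra.
Qed.

(** The shell is thin in terms of [|x|^2], so that the conclusion can be read as:
    a point of the constraint set that is almost as far as [x0] and no higher
    satisfies the multiplier rule for [f] plus a radial function. Here [c] is
    the multiplier of the objective and may vanish. *)
Lemma multipliers_near_sphere {x0 : 'rV[R]_n} {M : R} : S x0 -> f x0 = M%:E ->
  exists (x w : 'rV[R]_n) (theta c : R),
  [/\ (edom f `&` S) x, (f x <= M%:E)%E, dotv x0 x0 - 1 < dotv x x,
      0 <= c /\ c + enorm w = 1 &
      limiting_normal S x w /\
      limiting_normal (epi f) (pairv x (fine (f x)))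
        (pairv (- (c *: (theta *: x) + w)) (- c))].
Proof.
move=> Sx0 fx0; set q := dotv x0 x0.
have [b fb] := lsc_bounded_below f_proper f_lsc (shell_compact q).
have shell_x0 : shell q x0 by rewrite /shell /= -/q; apply/andP; split; lra.
have bM : 0 < M + b by have := fb _ shell_x0; rewrite fx0 lte_fin; lra.
(* On the boundary of the shell the penalty is [K], which lifts the cost above
   [- b + K = M], the cost of [x0]. *)
pose K := M + b; have K0 : 0 <= K by exact: ltW.
pose A := [set z | [/\ epi f z, shell q (lsubmx z) & lastv z <= M + 1]].
(* [B] only has to be compact and to contain the points of [S] lying in a
   neighborhood of the shell. *)
pose B := S `&` [set s | dotv s s <= q + 2].
have cA : compact A by exact: epi_shell_compact fb.
have cB : compact B.
  rewrite /B setIC; apply: compact_closedI => //; exact: sublevel_dotv_compact.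
have A_bounded z : A z -> - b <= lastv z.
  by move=> [zf zq _]; apply: ltW; rewrite -lte_fin (lt_le_trans (fb _ zq)).
have Ax0 : A (pairv x0 M).
  by split; rewrite /epi /= ?lsubmx_pairv ?lastv_pairv ?fx0//; lra.
have Bx0 : B (lsubmx (pairv x0 M)).
  by rewrite lsubmx_pairv; split => //; rewrite /= -/q; lra.
have /choice[p p_min] k := penalized_minimum K q k.+1%:R cA cB
  (ex_intro (A `*` B) (_, _) (conj Ax0 Bx0)).
have [[z s] [/= Az Bs] [phi phi_ge cvg_p]] :=
  compact_subsequence (compact_setX cA cB) (fun k => (p_min k).1).
have zs := penalty_limit_diagonal K q K0 A_bounded p_min phi_ge cvg_p Ax0 Bx0.
have z_min y (Ay : A y) (By : B (lsubmx y)) :=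
  penalty_limit_minimizes K q p_min cvg_p Ay By.
have [zf zq zM1] := Az; set x := lsubmx z in zs.
have zb : - b < lastv z by rewrite -lte_fin (lt_le_trans (fb _ zq)).
have zM : lastv z + K * (dotv x x - q) ^+ 2 <= M.
  have := z_min _ Ax0 Bx0.
  by rewrite /shell_cost lsubmx_pairv lastv_pairv -/q subrr expr0n mulr0 addr0.
have xq : (dotv x x - q) ^+ 2 < 1.
  have KE : K = M + b by [].
  by rewrite -(ltr_pM2l bM) -/K; lra.
have x_gt : q - 1 < dotv x x by nra.
have x_lt : dotv x x < q + 1 by nra.
have z_le : lastv z <= M.
  by apply: le_trans zM; rewrite lerDl mulr_ge0 ?sqr_ge0.
(* Lowering the last coordinate of [z] to [f x] would decrease the cost. *)
have fx : f x = (lastv z)%:E.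
  have [a fxa] : exists a, f x = a%:E.
    move: zf (f_proper x); rewrite /epi /= -/x; case: (f x) => [a _ _| |]//.
    by exists a.
  have az : a <= lastv z by move: zf; rewrite /epi /= -/x fxa lee_fin.
  have Ax : A (pairv x a).
    split; rewrite /epi /= ?lsubmx_pairv ?lastv_pairv ?fxa//.
    exact: le_trans zM1.
  have Bx : B (lsubmx (pairv x a)) by rewrite lsubmx_pairv zs.
  have := z_min _ Ax Bx; rewrite /shell_cost lsubmx_pairv lastv_pairv -/x lerD2r.
  by move=> za; rewrite fxa; congr _%:E; apply/eqP; rewrite eq_le az.
have cvg_z : (p (phi k)).1 @[k --> \oo] --> z := cvg_pair_fst cvg_p.
have cvg_s : (p (phi k)).2 @[k --> \oo] --> lsubmx z.
  by rewrite -/x zs; exact: cvg_pair_snd cvg_p.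
have cvg_x : dotv (lsubmx (p (phi k)).1) (lsubmx (p (phi k)).1) @[k --> \oo] -->
    dotv x x by apply: cvg_dotv; exact: cvg_lsubmx.
have cvg_last : lastv (p (phi k)).1 @[k --> \oo] --> lastv z by exact: cvg_lastv.
have last_lt : \forall k \near \oo, lastv (p (phi k)).1 < M + 1.
  by apply: (cvgr_lt _ cvg_last); lra.
have x_lt_near : \forall k \near \oo,
    dotv (lsubmx (p (phi k)).1) (lsubmx (p (phi k)).1) < q + 1.
  exact: (cvgr_lt _ cvg_x).
have x_gt_near : \forall k \near \oo,
    q - 1 < dotv (lsubmx (p (phi k)).1) (lsubmx (p (phi k)).1).
  exact: (cvgr_gt _ cvg_x).
(* The constraints defining [A] and [B], other than membership in [epi f] and
   [S], are strict at the limit: the minima are eventually local ones. *)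
have min_epi : \forall k \near \oo, \forall y \near within (epi f) (nbhs (p (phi k)).1),
    penalized K q (phi k).+1%:R (p (phi k)).1 (p (phi k)).2 <=
    penalized K q (phi k).+1%:R y (p (phi k)).2.
  near=> k.
  have near_last : \forall y \near (p (phi k)).1, lastv y < M + 1.
    by apply: (cvgr_lt _ (continuous_lastv _ _)); near: k.
  have near_lt : \forall y \near (p (phi k)).1, dotv (lsubmx y) (lsubmx y) < q + 1.
    by apply: (cvgr_lt _ (continuous_dotv_lsubmx _ _)); near: k.
  have near_gt : \forall y \near (p (phi k)).1, q - 1 < dotv (lsubmx y) (lsubmx y).
    by apply: (cvgr_gt _ (continuous_dotv_lsubmx _ _)); near: k.
  apply: filterS3 near_last near_lt near_gt => y ya yl yg yf.
  have [[_ Bpk] min_k] := p_min (phi k).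
  apply: (min_k (y, (p (phi k)).2)); split => //; split => //; last exact: ltW.
  by rewrite /shell /= !ltW.
have s_lt : \forall k \near \oo, dotv (p (phi k)).2 (p (phi k)).2 < q + 2.
  by apply: (cvgr_lt _ (cvg_dotv cvg_s cvg_s)); rewrite -/x; lra.
have min_S : \forall k \near \oo, \forall t \near within S (nbhs (p (phi k)).2),
    penalized K q (phi k).+1%:R (p (phi k)).1 (p (phi k)).2 <=
    penalized K q (phi k).+1%:R (p (phi k)).1 t.
  near=> k.
  have near_lt : \forall t \near (p (phi k)).2, dotv t t < q + 2.
    by apply: (cvgr_lt _ (continuous_dotv_self _ _)); near: k.
  apply: filterS near_lt => t tq St; have [[Apk _] min_k] := p_min (phi k).
  by apply: (min_k ((p (phi k)).1, t)); split => //; split => //; exact: ltW.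
have p_epi k : epi f (p (phi k)).1 by have [[[]]] := p_min (phi k).
have p_S k : S (p (phi k)).2 by have [[_ []]] := p_min (phi k).
have [w [c [c0 cw Nw Nepi]]] := limit_multipliers K q K0 p_epi p_S
  (fun k => ler0n R (phi k).+1) cvg_z cvg_s min_epi min_S.
exists x, w, (multiplier K q x), c; split => //.
- by split; [rewrite /edom /= fx ltry | rewrite zs; exact: Bs.1].
- by rewrite fx lee_fin.
- by split => //; rewrite fx /= /x -pairv_eta.
Unshelve. all: end_near. Qed.

(** If [c = 0] then [w] is a unit vector with [- w] a horizon subgradient, which
    the qualification condition forbids; otherwise the relation is divided by
    [c]. *)
Lemma qualification_tangency {x w : 'rV[R]_n} {theta c : R} :
  (edom f `&` S) x ->
  horizon_subdiff f x `&` [set - w | w in limiting_normal S x] = [set 0] ->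
  0 <= c -> c + enorm w = 1 -> limiting_normal S x w ->
  limiting_normal (epi f) (pairv x (fine (f x)))
    (pairv (- (c *: (theta *: x) + w)) (- c)) ->
  tangency_variety f S x.
Proof.
move=> domx qc; rewrite le_eqVlt => /predU1P[<- |c0 cw Nw Nepi].
  rewrite scale0r !add0r oppr0 => w1 Nw Nepi.
  have : (horizon_subdiff f x `&` [set - w | w in limiting_normal S x]) (- w).
    by split => //; exists w.
  rewrite qc /= => /eqP; rewrite oppr_eq0 => /eqP w0.
  by move: w1; rewrite w0 enorm0 => /eqP; rewrite eq_sym oner_eq0.
have ci0 : 0 < c^-1 by rewrite invr_gt0.
have cu : c^-1 * c = 1 by rewrite mulVf// gt_eqF.
split => //; exists theta, (- (theta *: x + c^-1 *: w)), (c^-1 *: w); split.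
- have := limiting_normalZ ci0 Nepi; rewrite /subdiff /= scale_pairv.
  by rewrite mulrN cu scalerN scalerDr (scalerA c^-1 c) cu scale1r.
- exact: limiting_normalZ.
- by rewrite opprD subrK addNr.
Qed.

End tangency.

(** * Coercivity and the pieces of the decomposition *)

Lemma coercive_onP {R : realType} {n : nat} {f : 'rV[R]_n -> \bar R}
    {S : set 'rV[R]_n} :
  coercive_on f S <->
  forall M : R, exists rho : R, forall x, S x -> rho < enorm x -> (M%:E < f x)%E.
Proof.
split=> [coer M|far xs Sxs xs_oo].
  apply: contrapT => /forallNP none.
  have /choice[xs xsP] : forall k : nat, exists x,
      [/\ S x, k%:R < enorm x & (f x <= M%:E)%E].
    move=> k; have /existsNP[x /not_implyP[Sx /not_implyP[kx /negP fx]]] := none k%:R.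
    by exists x; split => //; rewrite leNgt.
  have xs_oo : enorm (xs k) @[k --> \oo] --> +oo.
    apply/cvgryPgt => A; near=> k; have [_ kx _] := xsP k.
    by apply: lt_trans kx; near: k; exact: nbhs_infty_gtr.
  have Sxs k : S (xs k) by have [] := xsP k.
  have /cvgeyPgt/(_ M)[k _ /(_ k (leqnn k))] := coer xs Sxs xs_oo.
  by rewrite /= ltNge; have [_ _ ->] := xsP k.
apply/cvgeyPgt => M; have [rho rhoP] := far M.
have : \forall k \near \oo, rho < enorm (xs k) by move/cvgryPgt: xs_oo; apply.
by apply: filterS => k; exact: rhoP.
Unshelve. all: end_near. Qed.

(** [lim] takes the value [0] when there is no limit, so the value [+oo] is a
    genuine limit. *)
Lemma limit_value_pinftyP {R : realType} {phi : R -> R} :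
  limit_value phi = +oo%E <-> (phi t)%:E @[t --> +oo] --> +oo%E.
Proof.
split=> [|phioo]; last exact: cvg_lim.
rewrite /limit_value; have [|ncv] := pselect (cvg ((phi t)%:E @[t --> +oo])).
  by move=> + <-.
by rewrite dvgP.
Qed.

Section pieces.
Context {R : realType} {n : nat} {f : 'rV[R]_n -> \bar R} {S : set 'rV[R]_n}.
Context {l : nat} {C : 'I_l -> set 'rV[R]_n} {r : R} {m : nat}.
Context {F : 'I_l -> set 'rV[R]_m} {h : 'rV[R]_(m + 1) -> 'rV[R]_n}.
Context {p : nat} {Gam : 'I_p -> set 'rV[R]_n}.
Hypothesis decomp : decomposition_at_infinity f S C r F h Gam.

Lemma pieces_cover {x} : tangency_variety f S x -> r < enorm x ->
  exists k, Gam k x.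
Proof.
move=> Gx rx; have [[_ _ surj] _ _] := dec_h_homeomorphism decomp.
have [|z [[i _ Fiz] rz] <-] := surj x.
  by split => //=; apply/negP; rewrite -ltNge.
have [_ _ enumerate] := dec_pieces decomp.
have [|k _ Gk] := enumerate (h @` cylinder (connected_component (F i) (lsubmx z)) r).
  exists (connected_component (F i) (lsubmx z)) => //.
  by exists i => //; exists (lsubmx z).
exists k; rewrite Gk; exists z => //; split => //.
exact: connected_component_refl.
Qed.

Lemma piece_slice k {t} : r < t ->
  exists x, [/\ Gam k x, S x & enorm x = t].
Proof.
move=> rt; have [into _ _] := dec_pieces decomp.
have [|F' [i _ [a Fia F'E]] Gk] := into k; first by [].
have cyl : cylinder F' r (pairv a t).
  split; rewrite /= ?lsubmx_pairv ?lastv_pairv// -F'E.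
  exact: connected_component_refl.
have cylU : cylinder (\bigcup_i F i) r (pairv a t).
  by split; rewrite /= ?lsubmx_pairv ?lastv_pairv//; exists i.
exists (h (pairv a t)); split.
- by rewrite -Gk; exists (pairv a t).
- have [[hfun _ _] _ _] := dec_h_homeomorphism decomp.
  by have [[[]]] := hfun _ cylU.
- by rewrite (dec_h_norm decomp)// lastv_pairv.
Qed.

End pieces.

Theorem theorem4p6 (R : realType) (n : nat) (f : 'rV[R]_n -> \bar R)
  (S : set 'rV[R]_n)
  (f_proper : forall x, f x != -oo%E)
  (f_lsc : lower_semicontinuous f)
  (f_semialg : semialgebraic_efun f)
  (S_closed : closed S)
  (S_semialg : semialgebraic S)
  (domS_nonempty : edom f `&` S !=set0)
  (domS_unbounded : ~ bounded_set (edom f `&` S))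
  (QC : QC_infty f S)
  (l : nat) (C : 'I_l -> set 'rV[R]_n)
  (r : R) (m : nat) (F : 'I_l -> set 'rV[R]_m)
  (h : 'rV[R]_(m + 1) -> 'rV[R]_n)
  (p : nat) (Gam : 'I_p -> set 'rV[R]_n)
  (decomp : decomposition_at_infinity f S C r F h Gam)
  (fk : 'I_p -> R -> R)
  (fkP : forall k, radial_value f r (Gam k) (fk k)) :
  coercive_on f S <-> (forall k : 'I_p, limit_value (fk k) = +oo%E).
Proof.
split=> [/coercive_onP far k|lim_oo].
  apply/limit_value_pinftyP/cvgeyPgt => M; have [rho rhoP] := far M.
  near=> t; have rt : r < t by near: t; apply: nbhs_pinfty_gt; exact: num_real.
  have [x [Gx Sx xt]] := piece_slice decomp k rt.
  rewrite -(fkP k t x rt Gx xt); apply: rhoP => //; rewrite xt; near: t.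
  apply: nbhs_pinfty_gt; exact: num_real.
have [rho rho0 qc] := QC.
apply/coercive_onP => M.
have [T TP] : exists T : R, forall t, T < t -> forall k, (M%:E < (fk k t)%:E)%E.
  have : \forall t \near +oo, forall k, (M%:E < (fk k t)%:E)%E.
    apply: filter_forall => k.
    by have /limit_value_pinftyP/cvgeyPgt := lim_oo k; apply.
  by move=> [T [_ TP]]; exists T.
(* If [|x0| > rad], then [|x|^2 > |x0|^2 - 1] forces [|x| > rad - 1], and hence
   [x] is beyond [r], [T] and [rho]. *)
pose rad := 1 + `|r| + `|T| + rho.
have rad_ge : [/\ 0 <= rad, r <= rad - 1, T <= rad - 1 & rho <= rad - 1].
  have := ler_norm r; have := ler_norm T.
  have := normr_ge0 r; have := normr_ge0 T.
  by rewrite /rad => *; split; lra.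
have [rad0 r_rad T_rad rho_rad] := rad_ge.
exists rad => x0 Sx0 x0_far; rewrite ltNge; apply/negP => fx0.
have [a fx0a] : exists a, f x0 = a%:E.
  by move: (f_proper x0) fx0; case: (f x0) => [a _ _| |]//; exists a.
have [x [w [theta [c [domx fx x_far [c0 cw] [Nw Nepi]]]]]] :=
  multipliers_near_sphere f_proper f_lsc S_closed Sx0 fx0a.
have x_rad : rad - 1 < enorm x.
  move: x_far; rewrite -!sqr_enorm => x_far.
  have := enorm_ge0 x; nra.
have Gx : tangency_variety f S x.
  apply: (qualification_tangency domx _ c0 cw Nw Nepi); apply: qc; split => //=.
  by apply/negP; rewrite -ltNge; lra.
have rx : r < enorm x by lra.
have [k Gkx] := pieces_cover decomp Gx rx.
have : (M%:E < f x)%E.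
  by rewrite (fkP k (enorm x) x rx Gkx)//; apply: TP; lra.
by rewrite ltNge (le_trans fx)// -fx0a.
Unshelve. all: end_near. Qed.
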